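(* Let $B\subset\mathbb{R}^2$ be the standard Euclidean unit disk. For every convex body $K \subset \mathbb{R}^2$, $$\xi_{B}(K-K) \le \frac{4}{\sqrt{3}}\, \xi_{B}(K),$$ and this estimate is sharp, i.e. the constant $4/\sqrt3$ cannot be replaced by a smaller one that works for all such $K$.
   Context: A convex body is a compact convex set with nonempty interior; $K-K=\{x-y : x,y\in K\}$. For a closed polygonal line $Q=(q_1,\dots,q_m)$ in $\mathbb{R}^2$ let $\ell_B(Q)=\sum_{i=1}^m|q_{i+1}-q_i|$ (with $q_{m+1}=q_1$) be its Euclidean length. Let $\mathcal P_m(K)$ be the set of all $m$-tuples $(q_1,\dots,q_m)$ of points of $\mathbb{R}^2$ such that $\{q_1,\dots,q_m\}\not\subset \operatorname{int}K+t$ for every $t\in \mathbb{R}^2$. Define $$\xi_B(K)=\min_{m\ge2}\ \min_{Q\in\mathcal P_m(K)}\ell_B(Q).$$ (For smooth $K$ this is the length of the shortest closed Euclidean billiard trajectory in $K$; for general $K$ the formula is taken as the definition.) *)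

(* Defs.v *)
From HB Require Import structures.
From mathcomp Require Import all_boot all_order all_algebra.
From mathcomp Require Import all_classical all_reals all_analysis.

Set Implicit Arguments.
Unset Strict Implicit.
Unset Printing Implicit Defensive.

Import Order.TTheory GRing.Theory Num.Theory.
Import numFieldNormedType.Exports.

Local Open Scope classical_set_scope.
Local Open Scope ring_scope.

(* The library norm [`|v|] on ['rV[R]_n] is the sup norm. It induces the usual
   topology, so it is harmless in [compact] and [interior], but lengths need
   the Euclidean norm. *)
Definition enorm (R : realType) (v : 'rV[R]_2) : R :=
  Num.sqrt (\sum_(i < 2) v 0 i ^+ 2).

Definition convex_body (R : realType) (K : set 'rV[R]_2) : Prop :=
  [/\ compact K, convex_set K & interior K !=set0].

Definition diff_body (R : realType) (K : set 'rV[R]_2) : set 'rV[R]_2 :=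
  [set x - y | x in K & y in K].

Definition translate (R : realType) (A : set 'rV[R]_2) (t : 'rV[R]_2) :
  set 'rV[R]_2 := [set x + t | x in A].

(* [ordS i] is the cyclic successor of [i], so the line closes up. *)
Definition closed_length (R : realType) (m : nat) (q : 'I_m -> 'rV[R]_2) : R :=
  \sum_(i < m) enorm (q (ordS i) - q i).

Definition Pset (R : realType) (m : nat) (K : set 'rV[R]_2) :
  set ('I_m -> 'rV[R]_2) :=
  [set q | forall t : 'rV[R]_2, ~ (range q `<=` translate (interior K) t)].

Definition xi_lengths (R : realType) (K : set 'rV[R]_2) : set R :=
  [set l | exists m : nat, (2 <= m)%N /\
             exists2 q : 'I_m -> 'rV[R]_2, Pset K q & closed_length q = l].

(* The double minimum is written as the infimum of all the lengths;
   [xiB_eq_min] shows that the two agree as soon as the minimum is attained. *)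
Definition xiB (R : realType) (K : set 'rV[R]_2) : R := inf (xi_lengths K).

Lemma xiB_eq_min (R : realType) (K : set 'rV[R]_2) (l : R) :
  xi_lengths K l -> lbound (xi_lengths K) l -> xiB K = l.
Proof.
move=> Kl lbl; apply/eqP; rewrite eq_le; apply/andP; split.
- by apply: ge_inf => //; exists l.
- by apply: lb_le_inf => //; exists l.
Qed.

(* Main.v *)
(* Let w be the minimal width of K. The two points spanning the width of K - K
   in a given direction, which is twice that of K, cannot lie in the interior of
   a translate of K - K, so xi(K - K) <= 4 w. It remains to see that every closed
   polygon q of length less than sqrt 3 * w fits into the interior of K; after a slight
   dilation of q it is enough that q fits into K itself. If it does
   not, minimise the sum of the |q_i - t - k_i|^2 over t and over k_i in K: the
   residuals v_i sum to 0 and v_i is an outer normal of K at k_i. By Caratheodory,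
   0 is a combination x + y + z of nonnegative multiples of three of them, and then
     w * D <= h(x) + h(y) + h(z) <= <x,a> + <y,b> + <z,c> <= D / sqrt 3 * perim(a,b,c),
   where h is the support function of K, a, b, c are the corresponding vertices of
   q and D = max(|x|,|y|,|z|); the last step is Jung's theorem for the triangle
   with sides x, y, z.
   For the equilateral triangle K of height 3, the medial triangle gives
   xi(K) <= 3 sqrt 3, while K - K contains the disc of radius 3, into which every
   closed polygon of length less than 12 fits: xi(K - K) >= 12. *)
Require Import Defs.
From mathcomp Require Import all_boot all_order all_algebra.
From mathcomp Require Import ring lra.
From mathcomp Require Import all_classical all_reals all_analysis.

Import Order.TTheory GRing.Theory Num.Theory.
Import numFieldNormedType.Exports.

Local Open Scope classical_set_scope.
Local Open Scope ring_scope.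

(** * Euclidean geometry of the plane *)

Section Dot.
Context {R : realType}.
Implicit Types (u v w : 'rV[R]_2) (a r : R).

Definition dot u v : R := u 0 0 * v 0 0 + u 0 1 * v 0 1.

Lemma rV2P u v : u 0 0 = v 0 0 -> u 0 1 = v 0 1 -> u = v.
Proof.
move=> uv0 uv1; apply/rowP => i.
by case: (unliftP ord0 i) => [j ->|->]; rewrite ?(ord1 j) // (_ : lift _ _ = 1) //; apply/val_inj.
Qed.

Lemma enormE u : enorm u = Num.sqrt (dot u u).
Proof. by rewrite /enorm big_ord_recl big_ord1 /dot !expr2 (_ : lift _ _ = 1) //; apply/val_inj. Qed.

Lemma dotC u v : dot u v = dot v u.
Proof. by rewrite /dot; ring. Qed.
Lemma dotDl u v w : dot (u + v) w = dot u w + dot v w.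
Proof. by rewrite /dot !mxE; ring. Qed.
Lemma dotDr u v w : dot w (u + v) = dot w u + dot w v.
Proof. by rewrite /dot !mxE; ring. Qed.
Lemma dotZl a u v : dot (a *: u) v = a * dot u v.
Proof. by rewrite /dot !mxE; ring. Qed.
Lemma dotZr a u v : dot u (a *: v) = a * dot u v.
Proof. by rewrite /dot !mxE; ring. Qed.
Lemma dotNl u v : dot (- u) v = - dot u v.
Proof. by rewrite /dot !mxE; ring. Qed.
Lemma dotNr u v : dot u (- v) = - dot u v.
Proof. by rewrite /dot !mxE; ring. Qed.
Lemma dot0l u : dot 0 u = 0.
Proof. by rewrite /dot !mxE; ring. Qed.

Lemma dot_ge0 u : 0 <= dot u u.
Proof. by rewrite /dot; nra. Qed.

Lemma dot_eq0 u : dot u u = 0 -> u = 0.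
Proof. by move=> d0; apply: rV2P; rewrite !mxE; move: d0; rewrite /dot; nra. Qed.

Lemma enorm_ge0 u : 0 <= enorm u.
Proof. by rewrite enormE sqrtr_ge0. Qed.

Lemma enorm_sqr u : enorm u ^+ 2 = dot u u.
Proof. by rewrite enormE sqr_sqrtr // dot_ge0. Qed.

Lemma enorm_gt0 u : u != 0 -> 0 < enorm u.
Proof.
move=> u0; rewrite lt_neqAle enorm_ge0 andbT eq_sym; apply: contra u0 => /eqP n0.
by apply/eqP/dot_eq0; rewrite -enorm_sqr n0 expr0n.
Qed.

Lemma enorm_le u r : 0 <= r -> (enorm u <= r) = (dot u u <= r ^+ 2).
Proof. by move=> r0; rewrite -enorm_sqr ler_pXn2r // nnegrE enorm_ge0. Qed.

Lemma enormZ a u : enorm (a *: u) = `|a| * enorm u.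
Proof. by rewrite !enormE dotZl dotZr mulrA -expr2 sqrtrM ?sqr_ge0 // sqrtr_sqr. Qed.

Lemma enormN u : enorm (- u) = enorm u.
Proof. by rewrite -scaleN1r enormZ normrN1 mul1r. Qed.

Lemma enorm0 : enorm (0 : 'rV[R]_2) = 0.
Proof. by rewrite enormE dot0l sqrtr0. Qed.

Lemma dot_le u v : dot u v <= enorm u * enorm v.
Proof.
rewrite !enormE -sqrtrM ?dot_ge0 //; apply: le_trans (ler_norm _) _.
rewrite -sqrtr_sqr ler_sqrt ?mulr_ge0 ?dot_ge0 // -subr_ge0.
suff -> : dot u u * dot v v - dot u v ^+ 2 = (u 0 0 * v 0 1 - u 0 1 * v 0 0) ^+ 2.
  exact: sqr_ge0.
by rewrite /dot; ring.
Qed.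

Lemma ler_enormD u v : enorm (u + v) <= enorm u + enorm v.
Proof.
rewrite enorm_le ?addr_ge0 ?enorm_ge0 //.
rewrite sqrrD !enorm_sqr dotDl !dotDr (dotC v u) mulr2n.
by have := dot_le u v; lra.
Qed.

Lemma enormBC u v : enorm (u - v) = enorm (v - u).
Proof. by rewrite -enormN opprB. Qed.

Lemma ler_enormB u v w : enorm (u - v) <= enorm (u - w) + enorm (w - v).
Proof. by have := ler_enormD (u - w) (w - v); rewrite addrA subrK. Qed.

Definition row2 (a b : R) : 'rV[R]_2 := \row_(i < 2) (if i == 0 then a else b).
Lemma row2_0 a b : row2 a b 0 0 = a. Proof. by rewrite mxE. Qed.
Lemma row2_1 a b : row2 a b 0 1 = b. Proof. by rewrite mxE. Qed.
Definition row2E := (row2_0, row2_1).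

Lemma sqrt3_sqr : Num.sqrt 3 ^+ 2 = 3 :> R.
Proof. by rewrite sqr_sqrtr. Qed.
Lemma sqrt3_gt0 : 0 < Num.sqrt 3 :> R.
Proof. by rewrite sqrtr_gt0. Qed.

End Dot.

(** * Polygonal lines and Jung's theorem *)

Section Polyline.
Context {R : realType}.
Implicit Types (p : nat -> 'rV[R]_2) (a b c : 'rV[R]_2).

Definition perim a b c : R := enorm (a - b) + enorm (b - c) + enorm (c - a).

Lemma perimC a b c : perim a b c = perim b a c.
Proof. by rewrite /perim (enormBC a b) (enormBC b c) (enormBC c a); ring. Qed.
Lemma perimAC a b c : perim a b c = perim a c b.
Proof. by rewrite /perim (enormBC a b) (enormBC b c) (enormBC c a); ring. Qed.

Definition arclen p n : R := \sum_(0 <= i < n) enorm (p i.+1 - p i).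

Lemma arclen0 p : arclen p 0 = 0.
Proof. exact: big_geq. Qed.

Lemma arclenS p n : arclen p n.+1 = arclen p n + enorm (p n.+1 - p n).
Proof. exact: big_nat_recr. Qed.

Lemma enorm_arclen p {i j} : (i <= j)%N -> enorm (p j - p i) <= arclen p j - arclen p i.
Proof.
elim: j => [|j IH]; first by rewrite leqn0 => /eqP ->; rewrite !subrr enorm0.
rewrite leq_eqVlt => /predU1P[->|/IH {}IH]; first by rewrite !subrr enorm0.
by rewrite arclenS; have := ler_enormB (p j.+1) (p i) (p j); lra.
Qed.

(** The perimeter is symmetric, so the indices may be sorted. Each side is then at most the arc that
    it cuts off, the third arc passing through the closing point [p n = p 0]. *)
Lemma perim_arclen p n i j k : p n = p 0%N -> (i <= n)%N -> (j <= n)%N -> (k <= n)%N ->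
  perim (p i) (p j) (p k) <= arclen p n.
Proof.
move=> pn; wlog ij : i j k / (i <= j)%N => [H|].
  by case: (leqP i j) => [|/ltnW] ij Hi Hj Hk; [|rewrite perimC]; exact: H.
wlog jk : i j k ij / (j <= k)%N => [H|].
  case: (leqP j k) => [|/ltnW jk] Hi Hj Hk; first exact: H.
  case: (leqP i k) => [|/ltnW] ik; rewrite perimAC; first exact: H.
  by rewrite perimC; exact: H.
move=> _ _ kn; rewrite /perim.
have := enorm_arclen p ij; have := enorm_arclen p jk; have := enorm_arclen p kn.
have := enorm_arclen p (leq0n i); rewrite arclen0 pn subr0.
have := ler_enormB (p k) (p i) (p 0%N).
rewrite (enormBC (p i) (p j)) (enormBC (p j) (p k)) (enormBC (p 0%N) (p k)) (enormBC (p i) (p 0%N)).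
lra.
Qed.

Lemma point_on_segment a b (t : R) : 0 <= t -> t <= enorm (b - a) ->
  exists2 y, enorm (y - a) <= t & enorm (b - y) <= enorm (b - a) - t.
Proof.
move=> t0; set d := enorm (b - a) => td.
have [d0|d0] := eqVneq d 0.
  by exists a; rewrite -?/d; [rewrite subrr enorm0 | lra].
have {}d0 : 0 < d by rewrite lt_neqAle eq_sym d0 enorm_ge0.
exists (a + (t / d) *: (b - a)).
  by rewrite addrAC subrr add0r enormZ -/d ger0_norm ?divr_ge0 ?(ltW d0) // mulfVK ?gt_eqF.
rewrite (_ : b - _ = (1 - t / d) *: (b - a)).
  rewrite enormZ -/d ger0_norm ?subr_ge0 ?ler_pdivrMr ?mul1r //.
  by rewrite mulrBl mul1r mulfVK ?gt_eqF.
by rewrite scalerBl scale1r opprD addrA.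
Qed.

(* The disc is centred at the midpoint of [p 0] and the point of the line at
   half-length from it. *)
Lemma closed_line_in_disc p n : p n.+1 = p 0%N ->
  exists c, forall i, (i <= n)%N -> enorm (p i - c) <= arclen p n.+1 / 4.
Proof.
move=> pn; set L := arclen p n.+1.
have L0 : 0 <= L by apply: le_trans (enorm_ge0 (p n.+1 - p 0%N)) _;
  have := enorm_arclen p (leq0n n.+1); rewrite arclen0 subr0.
have exk : exists k, L / 2 <= arclen p k.+1 by exists n; rewrite -/L; lra.
(* Minimality of [k] puts the half-length point on the edge from [p k] to [p k.+1]. *)
have [k Lk kmin] := ex_minnP exk.
have kn : (k <= n)%N by apply: kmin; rewrite -/L; lra.
have kL : arclen p k <= L / 2.
  case: k {Lk kn} kmin => [|k] kmin; first by rewrite arclen0; lra.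
  by rewrite leNgt; apply/negP => /ltW /kmin; rewrite ltnn.
have [||y yk yk1] := @point_on_segment (p k) (p k.+1) (L / 2 - arclen p k).
- lra.
- by move: Lk; rewrite arclenS; lra.
have {}yk1 : enorm (p k.+1 - y) <= arclen p k.+1 - L / 2.
  by move: yk1; rewrite arclenS; lra.
(* An ellipse lies in the disc about its centre whose radius is half the sum of the focal distances;
   the foci are [p 0] and [y]. *)
have mid i : enorm (p i - p 0%N) + enorm (p i - y) <= L / 2 ->
    enorm (p i - 2^-1 *: (p 0%N + y)) <= L / 4.
  move=> h; rewrite (_ : _ - _ = 2^-1 *: ((p i - p 0%N) + (p i - y))); last first.
    by apply: rV2P; rewrite !mxE; field.
  rewrite enormZ ger0_norm; last by lra.
  by have := ler_enormD (p i - p 0%N) (p i - y); lra.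
exists (2^-1 *: (p 0%N + y)) => i i_n; apply: mid.
have [ik|ki] := leqP i k.
- have := enorm_arclen p (leq0n i); have := enorm_arclen p ik.
  have := ler_enormB (p i) y (p k); rewrite arclen0 (enormBC (p i) (p k)) (enormBC (p k) y).
  lra.
- have := enorm_arclen p (leqW i_n); rewrite -/L; have := enorm_arclen p ki.
  have := ler_enormB (p i) y (p k.+1); rewrite pn (enormBC (p 0%N)).
  lra.
Qed.

(** Cyclic indices become natural numbers, so that arcs are sums over intervals and index [n.+1]
    returns to the start. *)
Definition unroll {n} (q : 'I_n.+1 -> 'rV[R]_2) (k : nat) := q (inord (k %% n.+1)).

Lemma unroll_ord n (q : 'I_n.+1 -> 'rV[R]_2) (i : 'I_n.+1) : unroll q i = q i.
Proof. by rewrite /unroll modn_small // inord_val. Qed.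

Lemma unroll_closed n (q : 'I_n.+1 -> 'rV[R]_2) : unroll q n.+1 = unroll q 0%N.
Proof. by rewrite /unroll modnn mod0n. Qed.

Lemma closed_length_unroll n (q : 'I_n.+1 -> 'rV[R]_2) :
  closed_length q = arclen (unroll q) n.+1.
Proof.
rewrite /arclen big_mkord; apply: eq_bigr => i _.
rewrite unroll_ord /unroll; congr (enorm (q _ - _)).
by apply/val_inj; rewrite /= inordK ?ltn_mod.
Qed.

Lemma closed_length_ge0 m (q : 'I_m -> 'rV[R]_2) : 0 <= closed_length q.
Proof. by apply: sumr_ge0 => i _; exact: enorm_ge0. Qed.

Lemma perim_closed_length m (q : 'I_m -> 'rV[R]_2) i j k :
  perim (q i) (q j) (q k) <= closed_length q.
Proof.
case: m q i j k => [|n] q i j k; first by case: i.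
rewrite closed_length_unroll -!(unroll_ord n q).
by apply: perim_arclen; rewrite ?unroll_closed // ltnW.
Qed.

Lemma closed_polygon_in_disc m (q : 'I_m -> 'rV[R]_2) :
  exists c, forall i, enorm (q i - c) <= closed_length q / 4.
Proof.
case: m q => [|n] q; first by exists 0 => -[].
have [c cP] := closed_line_in_disc (unroll q) n (unroll_closed n q).
by exists c => i; rewrite closed_length_unroll -unroll_ord; apply: cP; rewrite -ltnS.
Qed.

End Polyline.

(** * Jung's constant for a triangle *)

Section Jung.
Context {R : realType}.
Implicit Types (x y z a b c e : 'rV[R]_2).

(** For a longest side x and the vector e from its midpoint to the apex: [N] = |x|^2, [E] = |e|^2,
    [A] and [B] are the absolute products of e with x and with x turned by a right angle, and [s] =
    1/sqrt 3. The conclusion says that the apex lies in the circumscribed disc of the equilateral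
    triangle on x. *)
Lemma jung_apex (s N E A B : R) : 3 * s ^+ 2 = 1 -> 0 < s -> 0 < N -> 0 <= A -> 0 <= B ->
  A ^+ 2 + B ^+ 2 = N * E -> E + A <= 3 / 4 * N -> E - s * B <= N / 4.
Proof.
(* The line [A + s * B = N / 2] carries a side of the equilateral triangle. Beyond it the bound on
   [E + A] suffices; inside, the three products below do. *)
move=> s3 s0 N0 A0 B0 NE EA; have [|AB] := leP (N / 2) (A + s * B); first by lra.
rewrite -(ler_pM2l N0); have {}NE : N * E = A ^+ 2 + 3 * (s * B) ^+ 2.
  by rewrite -NE exprMn mulrA s3 mul1r.
have sB0 : 0 <= s * B by rewrite mulr_ge0 // ltW.
move: (s * B) AB sB0 NE => g AB g0 NE; rewrite mulrBr NE.
have h1 : 0 <= A * (N / 2 - A) by apply: mulr_ge0 => //; lra.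
have h2 : 0 <= g * (N / 2 - g) by apply: mulr_ge0 => //; lra.
have h3 : 0 <= N * (N / 2 - A - g) by apply: mulr_ge0; lra.
nra.
Qed.

(* Jung's theorem for a triangle with side vectors [x], [y], [z]: the [e_i] are
   its vertices seen from the centre of the equilateral triangle erected on the
   longest side, on the same side as the third vertex. *)
Lemma jung_triangle x y z : x + y + z = 0 ->
  enorm y <= enorm x -> enorm z <= enorm x ->
  exists e1 e2 e3, [/\ x = e1 - e3, y = e2 - e1, z = e3 - e2 &
    [/\ enorm e1 <= enorm x / Num.sqrt 3, enorm e2 <= enorm x / Num.sqrt 3 &
        enorm e3 <= enorm x / Num.sqrt 3]].
Proof.
move=> xyz yx zx; set s : R := (Num.sqrt 3)^-1.
have s0 : 0 < s by rewrite invr_gt0 sqrt3_gt0.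
have s3 : 3 * s ^+ 2 = 1 by rewrite exprVn sqrt3_sqr divff.
have ex2 e : (enorm e <= enorm x * s) = (3 * dot e e <= dot x x).
  rewrite enorm_le ?mulr_ge0 ?enorm_ge0 ?(ltW s0) // exprMn enorm_sqr (_ : s ^+ 2 = 3^-1); last by lra.
  by apply/idP/idP; lra.
have [x0|x0] := eqVneq x 0.
  have y0 : y = 0.
    apply: dot_eq0; rewrite -enorm_sqr; move: yx (enorm_ge0 y).
    by rewrite x0 enorm0 => ? ?; apply/eqP; rewrite sqrf_eq0 eq_le; apply/andP.
  have z0 : z = 0 by move: xyz; rewrite x0 y0 !add0r.
  by exists 0, 0, 0; rewrite x0 y0 z0 subrr enorm0 mul0r.
have N0 : 0 < dot x x by rewrite -enorm_sqr exprn_gt0 // enorm_gt0.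
move: yx zx; rewrite !enorm_le ?enorm_ge0 // !enorm_sqr.
pose Jx := row2 (- x 0 1) (x 0 0).
(* Seen from the midpoint of side [x], the vertices are [x / 2], [e] and [- x / 2]. *)
pose e := 2^-1 *: (y - z).
have yE : y = e - 2^-1 *: x.
  have -> : x = - y - z by apply/eqP; rewrite -subr_eq0 opprD !opprK addrA xyz.
  by apply: rV2P; rewrite !mxE; field.
have zE : z = - e - 2^-1 *: x.
  have -> : x = - y - z by apply/eqP; rewrite -subr_eq0 opprD !opprK addrA xyz.
  by apply: rV2P; rewrite !mxE; field.
have dyE : dot y y = dot e e - dot e x + dot x x / 4.
  by rewrite yE /dot !mxE; field.
have dzE : dot z z = dot e e + dot e x + dot x x / 4.
  by rewrite zE /dot !mxE; field.
rewrite dyE dzE => yx zx.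
have EAB : `|dot e x| ^+ 2 + `|dot e Jx| ^+ 2 = dot x x * dot e e.
  by rewrite !real_normK ?num_real // /dot !row2E; ring.
have := @jung_apex s _ _ _ _ s3 s0 N0 (normr_ge0 _) (normr_ge0 _) EAB.
have EA : dot e e + `|dot e x| <= 3 / 4 * dot x x.
  by case: ler0P => _; lra.
move/(_ EA) => {EA}.
(* The centre is [- t *: Jx], at distance |x| / (2 sqrt 3) from the midpoint; the sign puts it on
   the side of [e]. *)
pose t := if dot e Jx <= 0 then s / 2 else - (s / 2).
have tB : t * dot e Jx = - (s * `|dot e Jx|) / 2.
  by rewrite /t; case: ler0P => _; field.
have t2 : 3 * t ^+ 2 = 4^-1.
  by rewrite /t; case: ifP => _; rewrite ?sqrrN; move: s3; nra.
move=> eB; exists (2^-1 *: x + t *: Jx), (e + t *: Jx), (- (2^-1 *: x) + t *: Jx).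
split.
- by apply: rV2P; rewrite !mxE; field.
- by rewrite yE; apply: rV2P; rewrite !mxE; field.
- by rewrite zE; apply: rV2P; rewrite !mxE; field.
have JJ : dot Jx Jx = dot x x by rewrite /dot !row2E; ring.
clearbody e; have xJ : dot x Jx = 0 by rewrite /dot !row2E; ring.
rewrite !ex2 !(dotDl, dotDr, dotZl, dotZr, dotNl, dotNr) JJ !(dotC Jx) xJ.
have tN : t * (t * dot x x) = dot x x / 12 by nra.
move: tB eB tN; clearbody t; clear; move: (dot x x) (dot e e) (dot e Jx) (s * _) => N E B sB tB eB tN.
by split; lra.
Qed.

(** Summation by parts turns the left side into products of the [e_i] with the sides of [a b c];
    Cauchy-Schwarz and Jung's radius finish. *)
Lemma jung_pairing x y z a b c : x + y + z = 0 ->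
  enorm y <= enorm x -> enorm z <= enorm x ->
  dot x a + dot y b + dot z c <= enorm x / Num.sqrt 3 * perim a b c.
Proof.
move=> xyz yx zx; have [e1 [e2 [e3 [xE yE zE]]]] := jung_triangle x y z xyz yx zx.
move: (enorm x / _) => r [r1 r2 r3].
have -> : dot x a + dot y b + dot z c =
    dot e1 (a - b) + dot e2 (b - c) + dot e3 (c - a).
  by rewrite xE yE zE /dot !mxE; ring.
rewrite /perim !mulrDr.
by apply: lerD; [apply: lerD|]; apply: le_trans (dot_le _ _) _;
  apply: ler_wpM2r => //; exact: enorm_ge0.
Qed.

End Jung.

(** * Cones in the plane *)

Section Cone.
Context {R : realType}.

Lemma planar_dependence (v : 'I_3 -> 'rV[R]_2) :
  exists2 w : 'I_3 -> R, \sum_i w i *: v i = 0 & exists i, 0 < w i.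
Proof.
pose M : 'M[R]_(3, 2) := \matrix_(i, j) v i 0 j.
have : kermx M != 0.
  by rewrite kermx_eq0 /row_free neq_ltn ltnS rank_leq_col.
case/rowV0Pn => w /sub_kermxP wM w0.
have wv (u : 'rV[R]_3) : u *m M = 0 -> \sum_i u 0 i *: v i = 0.
  move=> /matrixP uM; apply/rowP => j; have := uM 0 j.
  by rewrite !mxE summxE => uMj; rewrite -[RHS]uMj; apply: eq_bigr => i _; rewrite !mxE.
have [i wi] : exists i, w 0 i != 0.
  apply/existsP; rewrite -negb_forall; apply: contra w0 => /forallP w0.
  by apply/eqP/rowP => i; rewrite mxE; exact/eqP.
have [wi0|wi0] := ltP 0 (w 0 i).
  by exists (w 0); [exact: wv | exists i].
exists ((- w) 0); first by apply: wv; rewrite mulNmx wM oppr0.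
by exists i; rewrite mxE oppr_gt0 lt_neqAle wi.
Qed.

(** Caratheodory's step: a multiple of a linear dependence is subtracted until the first coefficient
    vanishes, namely where the ratio [a i / w i] is least among positive [w i]. *)
Lemma cone_drop (v : 'I_3 -> 'rV[R]_2) (a : 'I_3 -> R) : (forall i, 0 <= a i) ->
  exists b : 'I_3 -> R, [/\ forall i, 0 <= b i, exists i, b i = 0 &
    \sum_i a i *: v i = \sum_i b i *: v i].
Proof.
move=> a0; have [w wv [i1 wi1]] := planar_dependence v.
case: (@arg_minP _ _ _ i1 (fun i => 0 < w i) (fun i => a i / w i) wi1) => k wk kmin.
exists (fun i => a i - a k / w k * w i); split.
- move=> i; rewrite subr_ge0; have [wi|wi] := ltP 0 (w i).
    by rewrite -ler_pdivlMr //; exact: kmin.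
  by apply: le_trans (a0 i); rewrite mulr_ge0_le0 // divr_ge0 // ltW.
- by exists k; rewrite mulfVK ?gt_eqF // subrr.
- rewrite [RHS](eq_bigr (fun i => a i *: v i - (a k / w k) *: (w i *: v i))); last first.
    by move=> i _; rewrite scalerBl scalerA.
  by rewrite sumrB -scaler_sumr wv scaler0 subr0.
Qed.

(** By induction on [s]: the new vector joins the two already found, and one of the three is
    dropped. [i0] serves the empty sum. *)
Lemma cone_pair (T : Type) (v : T -> 'rV[R]_2) (s : seq T) (i0 : T) :
  exists i j a b, [/\ 0 <= a, 0 <= b & \sum_(i <- s) v i = a *: v i + b *: v j].
Proof.
elim: s => [|h s [i [j [a [b [a0 b0 vs]]]]]].
  by exists i0, i0, 0, 0; rewrite big_nil !scale0r addr0.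
pose f := tnth [tuple h; i; j]; pose c := tnth [tuple 1; a; b].
have c0 l : 0 <= c l.
  by rewrite /c (tnth_nth 0); case: l => -[|[|[|]]] //= _; rewrite ler01.
have [d [d0 [k dk] cd]] := cone_drop (v \o f) c c0.
exists (f (lift k ord0)), (f (lift k (lift ord0 ord0))), (d (lift k ord0)), (d (lift k (lift ord0 ord0))).
split=> //; rewrite big_cons vs.
transitivity (\sum_i c i *: (v \o f) i).
  rewrite !big_ord_recl big_ord0 /c /f /= !(tnth_nth h) !(tnth_nth 0) /=.
  by rewrite scale1r addr0.
by rewrite cd (bigD1_ord k) //= dk scale0r add0r !big_ord_recl big_ord0 addr0.
Qed.

End Cone.

(** * Polygons that do not fit *)

Section Fit.
Context {R : realType}.
Implicit Types (K : set 'rV[R]_2) (x y t : 'rV[R]_2).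

Lemma convex_combination K x y (r : R) : convex_set K -> K x -> K y ->
  0 <= r -> r <= 1 -> K (r *: x + (1 - r) *: y).
Proof.
move=> cK Kx Ky r0 r1.
by have := cK x y (Itv01 r0 r1); rewrite !inE => /(_ Kx Ky).
Qed.

Lemma entry_continuous (T : topologicalType) m n i j :
  continuous (fun M : 'M[T]_(m, n) => M i j).
Proof.
move=> /= M s /= ns.
exists (fun i' j' => if (i' == i) && (j' == j) then s else setT).
  move=> i' j'; case: ifP => [/andP[/eqP-> /eqP->] //|_]; exact: filterT.
by move=> N /= /(_ i j); rewrite !eqxx.
Qed.

Definition centroid n (a : 'I_n.+1 -> 'rV[R]_2) := n.+1%:R^-1 *: \sum_i a i.

Lemma sum_centroid n (a : 'I_n.+1 -> 'rV[R]_2) : \sum_i (a i - centroid n a) = 0.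
Proof.
rewrite sumrB sumr_const card_ord -scaler_nat scalerA divff ?pnatr_eq0 //.
by rewrite scale1r subrr.
Qed.

(** The least sum of squares over all translations, by [centroid_min]. The translation is thus
    eliminated, and only the points of the compact body remain to be varied. *)
Definition deviation n (a : 'I_n.+1 -> 'rV[R]_2) :=
  \sum_i dot (a i - centroid n a) (a i - centroid n a).

Lemma centroid_min n (a : 'I_n.+1 -> 'rV[R]_2) t :
  deviation n a <= \sum_i dot (a i - t) (a i - t).
Proof.
rewrite /deviation; set g := centroid n a.
rewrite [leRHS](eq_bigr (fun i => dot (a i - g) (a i - g) +
    (2 * dot (a i - g) (g - t) + dot (g - t) (g - t)))); last first.
  by move=> i _; rewrite /dot !mxE; ring.
rewrite [leRHS]big_split /= lerDl big_split /= -mulr_sumr.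
have dot_sum (F : 'I_n.+1 -> 'rV[R]_2) u : \sum_i dot (F i) u = dot (\sum_i F i) u.
  by rewrite (big_morph (dot^~ u) (fun x y => dotDl x y u) (dot0l u)).
rewrite dot_sum sum_centroid dot0l mulr0 add0r.
by apply: sumr_ge0 => i _; exact: dot_ge0.
Qed.

Lemma deviation_continuous (T : topologicalType) n (a : 'I_n.+1 -> T -> 'rV[R]_2) :
  (forall i, continuous (a i)) -> continuous (fun s => deviation n (a^~ s)).
Proof.
move=> ca; have csum : continuous (fun s => \sum_i a i s).
  by apply: continuous_big => // z; exact: add_continuous.
have cw i : continuous (fun s => a i s - centroid n (a^~ s)).
  move=> s; apply: cvgB; first exact: ca.
  by apply: cvgZl_tmp; exact: csum.
apply: continuous_big => [|i _ s]; first exact: add_continuous.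
have cwl l : continuous (fun s => (a i s - centroid n (a^~ s)) 0 l).
  by move=> r; exact: (continuous_comp (cw i r) (@coord_continuous _ _ _ 0 l _)).
by apply: cvgD; apply: cvgM; exact: cwl.
Qed.

Lemma exists_min_deviation n K (q : 'I_n.+1 -> 'rV[R]_2) : compact K -> K !=set0 ->
  exists2 k : 'I_n.+1 -> 'rV[R]_2, forall i, K (k i) &
  forall k' : 'I_n.+1 -> 'rV[R]_2, (forall i, K (k' i)) ->
    deviation n (fun i => q i - k i) <= deviation n (fun i => q i - k' i).
Proof.
move=> cK [x0 Kx0].
(* Tuples of points are rows with entries in the plane, so that the product [A] is compact. *)
pose F (k : 'rV['rV[R]_2]_n.+1) := deviation n (fun i => q i - k 0 i).
pose A := [set k : 'rV['rV[R]_2]_n.+1 | forall i, K (k 0 i)].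
have cB i : continuous (fun v : 'rV[R]_2 => q i - v).
  by move=> v; apply: (@continuousB R _ _ (cst (q i)) id); [exact: cst_continuous | exact: cvg_id].
have ck i : continuous (fun k : 'rV['rV[R]_2]_n.+1 => q i - k 0 i).
  by move=> k; exact: (continuous_comp (@entry_continuous _ _ _ 0 i k) (cB i _)).
have cF : continuous F := deviation_continuous _ n _ ck.
have cA : compact A by exact: (@rV_compact _ n.+1 (fun=> K) (fun=> cK)).
have A0 : A !=set0 by exists (\row__ x0) => i; rewrite mxE.
have [k] := compact_EVT_min A0 cA (continuous_subspaceT cF).
rewrite inE => Ak kmin; exists (k 0) => //= k' Kk'.
have := kmin (\row_i k' i); rewrite inE => /(_ _)/le_trans; apply.
  by move=> i; rewrite mxE.
by rewrite /F; under eq_fun do rewrite mxE.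
Qed.

Lemma obstruction n K (q : 'I_n.+1 -> 'rV[R]_2) :
  compact K -> convex_set K -> K !=set0 ->
  exists k v t, [/\ forall i, K (k i), forall i, q i = k i + t + v i,
    \sum_i v i = 0 & forall i x, K x -> dot (v i) x <= dot (v i) (k i)].
Proof.
move=> cK conK K0; have [k Kk kmin] := exists_min_deviation n K q cK K0.
set t := centroid n (fun i => q i - k i); pose v i := q i - k i - t.
exists k, v, t; split=> //.
- by move=> i; apply: rV2P; rewrite !mxE; ring.
- exact: sum_centroid.
move=> i x Kx; rewrite -subr_le0 -dotNr -dotDr.
(* First variation: [k i] moves towards [x] while [t] stays fixed, which [centroid_min] permits. *)
set d := x - k i; have small r : 0 <= r -> r <= 1 -> 0 <= r * (r * dot d d - 2 * dot (v i) d).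
  move=> r0 r1; pose k' j := if j == i then r *: x + (1 - r) *: k i else k j.
  have Kk' j : K (k' j) by rewrite /k'; case: ifP => // _; exact: convex_combination.
  have := le_trans (kmin k' Kk') (centroid_min _ _ t).
  rewrite /deviation -/t (bigD1 i) //= [leRHS](bigD1 i) //=
    {1 2}(_ : k' i = r *: x + (1 - r) *: k i); last by rewrite /k' eqxx.
  rewrite [X in _ <= _ + X](eq_bigr (fun j => dot (v j) (v j))); last first.
    by move=> j /negbTE ji; rewrite /k' ji.
  rewrite lerD2r -subr_ge0 => /le_trans; apply.
  rewrite le_eqVlt; apply/orP; left; apply/eqP.
  by rewrite /v /d /dot !mxE; ring.
rewrite leNgt; apply/negP => vd0.
have dd0 := dot_ge0 d; set D := dot d d in small dd0; set c := dot (v i) d in small vd0.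
have Dc : 0 < D + c by lra.
(* This [r] gives [r * D <= c < 2 * c], contradicting [small]. *)
have r0 : 0 < c / (D + c) by rewrite divr_gt0.
have r1 : c / (D + c) <= 1 by rewrite ler_pdivrMr // mul1r; lra.
have := small _ (ltW r0) r1; rewrite pmulr_rge0 // subr_ge0.
rewrite mulrAC ler_pdivlMr //; nra.
Qed.

End Fit.

(** * Width *)

Section Width.
Context {R : realType}.
Implicit Types (K A : set 'rV[R]_2) (u v x y z a b c : 'rV[R]_2) (w M : R).

(** The minimal width of [K] is at least [w], stated through upper bounds [M] of the extent rather
    than a supremum, and for directions [v] of any length. *)
Definition width_ge K w := forall v M,
  (forall x y, K x -> K y -> dot v (x - y) <= M) -> w * enorm v <= M.

Definition maximizes K v k := forall x, K x -> dot v x <= dot v k.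

(* [- x = y + z], so the width of [K] along [x] is at most
   [h x + h y + h z], where [h] is the support function of [K]. *)
Lemma width_le_support K w x y z a b c : width_ge K w -> x + y + z = 0 ->
  maximizes K x a -> maximizes K y b -> maximizes K z c ->
  w * enorm x <= dot x a + dot y b + dot z c.
Proof.
move=> Kw xyz xa yb zc; apply: Kw => p r Kp Kr.
have -> : dot x (p - r) = dot x p + dot y r + dot z r - dot (x + y + z) r.
  by rewrite !dotDl dotDr dotNr; ring.
rewrite xyz dot0l subr0.
by apply: lerD; [apply: lerD|]; [exact: xa|exact: yb|exact: zc].
Qed.

Lemma width_le_perim_longest K w x y z a b c a' b' c' :
  width_ge K w -> x + y + z = 0 -> x != 0 ->
  enorm y <= enorm x -> enorm z <= enorm x ->
  maximizes K x a' -> maximizes K y b' -> maximizes K z c' ->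
  dot x a' + dot y b' + dot z c' <= dot x a + dot y b + dot z c ->
  Num.sqrt 3 * w <= perim a b c.
Proof.
move=> Kw xyz x0 yx zx xa yb zc le_abc.
have := jung_pairing x y z a b c xyz yx zx.
move/(le_trans le_abc)/(le_trans (width_le_support _ _ _ _ _ _ _ _ Kw xyz xa yb zc)).
rewrite [_ * enorm x]mulrC -mulrA ler_pM2l ?enorm_gt0 //.
by rewrite mulrC ler_pdivlMr ?sqrt3_gt0 // mulrC.
Qed.

(** A cyclic rotation brings the longest of the three vectors to the front; it is nonzero because
    [x] is. *)
Lemma width_le_perim K w x y z a b c a' b' c' :
  width_ge K w -> x + y + z = 0 -> x != 0 ->
  maximizes K x a' -> maximizes K y b' -> maximizes K z c' ->
  dot x a' + dot y b' + dot z c' <= dot x a + dot y b + dot z c ->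
  Num.sqrt 3 * w <= perim a b c.
Proof.
move=> Kw xyz x0 xa yb zc le_abc.
have gt0 u : enorm x <= enorm u -> u != 0.
  by apply: contraTneq => ->; rewrite enorm0 -ltNge enorm_gt0.
have yzx : y + z + x = 0 by rewrite addrC addrA.
have zxy : z + x + y = 0 by rewrite -addrA addrC.
have [yx|/ltW xy] := leP (enorm y) (enorm x); have [zx|/ltW xz] := leP (enorm z) (enorm x).
- exact: (width_le_perim_longest _ _ _ _ _ _ _ _ _ _ _ Kw xyz x0 yx zx xa yb zc le_abc).
- rewrite perimAC perimC; apply: (width_le_perim_longest _ _ _ _ _ _ _ _ _ _ _ Kw zxy _ xz _ zc xa yb).
  + exact: gt0.
  + exact: le_trans xz.
  + by move: le_abc; lra.
- rewrite perimC perimAC; apply: (width_le_perim_longest _ _ _ _ _ _ _ _ _ _ _ Kw yzx _ _ xy yb zc xa).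
  + exact: gt0.
  + exact: le_trans xy.
  + by move: le_abc; lra.
have [zy|/ltW yz] := leP (enorm z) (enorm y).
- rewrite perimC perimAC; apply: (width_le_perim_longest _ _ _ _ _ _ _ _ _ _ _ Kw yzx _ zy xy yb zc xa).
  + exact: gt0.
  + by move: le_abc; lra.
- rewrite perimAC perimC; apply: (width_le_perim_longest _ _ _ _ _ _ _ _ _ _ _ Kw zxy _ xz yz zc xa yb).
  + exact: gt0.
  + by move: le_abc; lra.
Qed.

Lemma short_polygon_fits K w m (q : 'I_m -> 'rV[R]_2) :
  compact K -> convex_set K -> K !=set0 -> width_ge K w ->
  closed_length q < Num.sqrt 3 * w -> exists t, forall i, K (q i - t).
Proof.
case: m q => [|n] q cK conK K0 Kw; first by exists 0 => -[].
rewrite ltNge => /negP Lw.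
have [k [v [t [Kk qE sumv vmax]]]] := obstruction n K q cK conK K0.
have [/forallP v0|] := boolP [forall i, v i == 0].
  by exists t => i; rewrite qE (eqP (v0 i)) addr0 addrK.
rewrite negb_forall => /existsP[i0 vi0]; case: Lw.
(* One nonzero residual is kept apart, so that reducing the others to two leaves a nontrivial
   relation. *)
have [i [j [a [b [a0 b0 vij]]]]] := cone_pair _ v [seq i <- index_enum 'I_n.+1 | i != i0] i0.
have xyz : v i0 + a *: v i + b *: v j = 0.
  by move: sumv; rewrite (bigD1 i0) //= -big_filter vij addrA.
apply: le_trans (perim_closed_length _ q i0 i j).
have maxZ r l : 0 <= r -> maximizes K (r *: v l) (k l).
  by move=> r0 x Kx; rewrite !dotZl ler_wpM2l // vmax.
apply: (width_le_perim _ _ _ _ _ _ _ _ _ _ _ Kw xyz vi0 (vmax i0) (maxZ a i a0) (maxZ b j b0)).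
(* With [q = k + t + v], the terms in [t] cancel since the three vectors sum to 0, and those in [v]
   are nonnegative. *)
rewrite !qE !dotDr !dotZl.
have := congr1 (dot^~ t) xyz; rewrite !dotDl !dotZl dot0l => eqt.
have := dot_ge0 (v i0); have := mulr_ge0 a0 (dot_ge0 (v i)); have := mulr_ge0 b0 (dot_ge0 (v j)).
by move: eqt; lra.
Qed.

(** * Interior points and the bounds of [xiB] by widths *)

Lemma interior_shrink K x k (r : R) : convex_set K -> interior K x -> K k ->
  0 < r -> r < 1 -> interior K (r *: k + (1 - r) *: x).
Proof.
move=> cK /nbhs_ballP[e /= e0 xe] Kk r0 r1; have s0 : 0 < 1 - r by rewrite subr_gt0.
apply/nbhs_ballP; exists ((1 - r) * e) => /=; first exact: mulr_gt0.
move=> y; rewrite -ball_normE /= => ye.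
pose x1 := (1 - r)^-1 *: (y - r *: k).
have -> : y = r *: k + (1 - r) *: x1.
  by rewrite scalerA divff ?gt_eqF // scale1r addrC subrK.
apply: convex_combination => //; try exact: ltW.
apply: xe; rewrite -ball_normE /=.
have -> : x - x1 = (1 - r)^-1 *: (r *: k + (1 - r) *: x - y).
  by apply: rV2P; rewrite !mxE; field; rewrite gt_eqF.
by rewrite normrZ ger0_norm ?invr_ge0 ?(ltW s0) // ltr_pdivrMl.
Qed.

Lemma interior_push A x u : interior A x -> exists2 r : R, 0 < r & A (x + r *: u).
Proof.
move=> /nbhs_ballP[e /= e0 xe]; have u0 : 0 < `|u| + 1 by rewrite ltr_wpDl.
exists (e / (`|u| + 1)); first exact: divr_gt0.
apply: xe; rewrite -ball_normE /= opprD addrA subrr add0r normrN normrZ.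
rewrite gtr0_norm ?divr_gt0 // mulrAC ltr_pdivrMr // ltr_pM2l // ltrDl //.
Qed.

Lemma closed_lengthZ m (q : 'I_m -> 'rV[R]_2) (r : R) : 0 <= r ->
  closed_length (fun i => r *: q i) = r * closed_length q.
Proof.
move=> r0; rewrite /closed_length mulr_sumr; apply: eq_bigr => i _.
by rewrite -scalerBr enormZ ger0_norm.
Qed.

Lemma width_le_length K w m (q : 'I_m -> 'rV[R]_2) : convex_body K -> width_ge K w ->
  Pset K q -> Num.sqrt 3 * w <= closed_length q.
Proof.
move=> [cK conK [x Kx]] Kw; rewrite leNgt => Pq; apply/negP => Lw.
have L0 := closed_length_ge0 _ q.
have W0 : 0 < Num.sqrt 3 * w by exact: le_lt_trans Lw.
set L := closed_length q in Lw L0; set W := Num.sqrt 3 * w in Lw W0.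
(* Strictly between [L / W] and 1: the polygon enlarged by [r^-1] is still shorter than [W], and
   shrinking back towards [x] lands in the interior. *)
pose r := (L / W + 1) / 2.
have LW : 0 <= L / W < 1 by rewrite divr_ge0 ?(ltW W0) //= ltr_pdivrMr // mul1r.
have [r0 r1 rL] : [/\ 0 < r, r < 1 & L / W < r] by rewrite /r; split; lra.
have [||t Kt] := short_polygon_fits K w _ (fun i => r^-1 *: q i) cK conK _ Kw.
- by exists x; exact: interior_subset.
- rewrite closed_lengthZ ?invr_ge0 ?ltW //.
  by rewrite ltr_pdivrMl // -ltr_pdivrMr.
apply: (Pq (r *: t - (1 - r) *: x)) => _ [i _ <-].
exists (r *: (r^-1 *: q i - t) + (1 - r) *: x); first exact: interior_shrink.
by apply: rV2P; rewrite !mxE; field; rewrite gt_eqF.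
Qed.

(** The witness is the segment from 0 to [M *: u], run both ways. In a translate of the interior its
    far end could be pushed further along [u], exceeding the extent [M]. *)
Lemma xi_lengths_width A u M : enorm u = 1 -> 0 <= M ->
  (forall a b, A a -> A b -> dot u (a - b) <= M) -> xi_lengths A (2 * M).
Proof.
move=> u1 M0 AM; exists 2; split=> //.
pose q (i : 'I_2) := if i == 0 then 0 else M *: u.
exists q; last first.
  rewrite /closed_length big_ord_recl big_ord1 /q /=.
  by rewrite subr0 sub0r enormN enormZ u1 ger0_norm // mulr1 mulr2n mulrDl !mul1r.
move=> t qA.
have [a Aa at0] := qA (q 0) (imageT _ _); have [b Ab bt] := qA (q 1) (imageT _ _).
move: at0 bt; rewrite /q /= => at0 bt.
have bE : b = M *: u + a.
  by rewrite -bt -[RHS]addrA [t + a]addrC at0 addr0.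
have uu : dot u u = 1 by rewrite -enorm_sqr u1 expr1n.
have [s s0] := interior_push _ _ u Ab.
move=> /AM/(_ (interior_subset Aa)).
rewrite bE (_ : M *: u + a + s *: u - a = (M + s) *: u); last first.
  by apply: rV2P; rewrite !mxE; ring.
by rewrite dotZr uu; lra.
Qed.

Lemma xi_lengths_ge0 A : lbound (xi_lengths A) 0.
Proof. by move=> l [m [_ [q _ <-]]]; exact: closed_length_ge0. Qed.

Lemma xiB_le_width A u M : enorm u = 1 -> 0 <= M ->
  (forall a b, A a -> A b -> dot u (a - b) <= M) -> xiB A <= 2 * M.
Proof.
move=> u1 M0 AM; apply: ge_inf; last exact: (xi_lengths_width _ u).
by exists 0; exact: xi_lengths_ge0.
Qed.

Lemma diff_body_width K : K !=set0 -> width_ge K (xiB (diff_body K) / 4).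
Proof.
move=> [x0 Kx0] v M vM.
have M0 : 0 <= M by have := vM _ _ Kx0 Kx0; rewrite subrr dotC dot0l.
have [->|v0] := eqVneq v 0; first by rewrite enorm0 mulr0.
have n0 := enorm_gt0 v v0.
have : xiB (diff_body K) <= 2 * (2 * M / enorm v).
  apply: (xiB_le_width _ ((enorm v)^-1 *: v)).
  - by rewrite enormZ gtr0_norm ?invr_gt0 // mulVf ?gt_eqF.
  - by rewrite divr_ge0 ?mulr_ge0 // ltW.
  move=> _ _ [x Kx [y Ky <-]] [x' Kx' [y' Ky' <-]].
  rewrite dotZl mulrC ler_pM2r ?invr_gt0 //.
  rewrite (_ : x - y - (x' - y') = (x - x') + (y' - y)); last first.
    by apply: rV2P; rewrite !mxE; ring.
  by rewrite dotDr; have := vM _ _ Kx Kx'; have := vM _ _ Ky' Ky; lra.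
rewrite mulrA ler_pdivlMr //; lra.
Qed.

(** A lower bound of an infimum requires a nonempty set of lengths; bounded extent in one direction
    provides a segment. *)
Lemma xi_lengths_neq0 A M : (forall x, A x -> `|x 0 0| <= M) -> xi_lengths A !=set0.
Proof.
move=> AM; exists (2 * (2 * `|M|)); apply: (xi_lengths_width _ (row2 1 0)).
- by rewrite enormE /dot !row2E mulr0 addr0 mulr1 sqrtr1.
- by rewrite mulr_ge0.
move=> a b /AM Ma /AM Mb; rewrite /dot !row2E !mxE.
by have := ler_norm M; move: Ma Mb; rewrite !ler_norml => /andP[? ?] /andP[? ?]; lra.
Qed.

Lemma compact_xi_lengths K : compact K -> xi_lengths K !=set0.
Proof.
move=> /compact_bounded[M [_ KM]]; apply: (xi_lengths_neq0 _ (`|M| + 1)) => x Kx.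
have : `|x| <= `|M| + 1 by apply: KM Kx; rewrite (le_lt_trans (ler_norm _)) // ltrDl.
by apply: le_trans; rewrite /Num.norm /= mx_normrE; apply: (le_bigmax _ (fun i => `|x i.1 i.2|) (0, 0)).
Qed.

Lemma width_le_xiB K w : convex_body K -> width_ge K w -> Num.sqrt 3 * w <= xiB K.
Proof.
move=> bK Kw; apply: lb_le_inf; first by apply: compact_xi_lengths; case: bK.
by move=> l [m [_ [q Pq <-]]]; exact: width_le_length Pq.
Qed.

Lemma xiB_diff_body_le K : convex_body K ->
  xiB (diff_body K) <= 4 / Num.sqrt 3 * xiB K.
Proof.
move=> bK; have K0 : K !=set0.
  by case: bK => _ _ [x Kx]; exists x; exact: interior_subset.
have := width_le_xiB _ _ bK (diff_body_width _ K0).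
rewrite mulrAC ler_pdivlMr ?sqrt3_gt0 //; lra.
Qed.

End Width.

(** * The equilateral triangle *)

Section Triangle.
Context {R : realType}.
Implicit Types (p : 'rV[R]_2).

(** Unit outer normals of the triangle, and also the points where its unit incircle touches the
    sides, hence the side midpoints. *)
Definition tri_normal (i : 'I_3) : 'rV[R]_2 :=
  tnth [tuple row2 0 (-1); row2 (Num.sqrt 3 / 2) (1 / 2); row2 (- (Num.sqrt 3 / 2)) (1 / 2)] i.

Definition triangle : set 'rV[R]_2 := [set p | forall i, dot (tri_normal i) p <= 1].

Definition I3_1 : 'I_3 := lift ord0 ord0.
Definition I3_2 : 'I_3 := lift ord0 (lift ord0 ord0).

Lemma tri_normal0 : tri_normal ord0 = row2 0 (-1). Proof. by []. Qed.
Lemma tri_normal1 : tri_normal I3_1 = row2 (Num.sqrt 3 / 2) (1 / 2). Proof. by []. Qed.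
Lemma tri_normal2 : tri_normal I3_2 = row2 (- (Num.sqrt 3 / 2)) (1 / 2). Proof. by []. Qed.
Definition tri_normalE := (tri_normal0, tri_normal1, tri_normal2).

Lemma forall_I3 (P : 'I_3 -> Prop) : (forall i, P i) <-> [/\ P ord0, P I3_1 & P I3_2].
Proof.
split=> [H|[P0 P1 P2] i]; first by split; exact: H.
by case: (unliftP ord0 i) => [j|] -> //; case: (unliftP ord0 j) => [l|] -> //; rewrite (ord1 l).
Qed.

Lemma sum_I3 (F : 'I_3 -> R) : \sum_i F i = F ord0 + F I3_1 + F I3_2.
Proof. by rewrite !big_ord_recl big_ord0 addr0 addrA. Qed.

Lemma dot_tri_normal i : dot (tri_normal i) (tri_normal i) = 1.
Proof.
have s3 := @sqrt3_sqr R; move: i; apply/forall_I3.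
by rewrite !tri_normalE /dot !row2E; split; lra.
Qed.

Lemma triangleP p : triangle p <->
  [/\ - p 0 1 <= 1, Num.sqrt 3 / 2 * p 0 0 + p 0 1 / 2 <= 1 &
      - (Num.sqrt 3 / 2 * p 0 0) + p 0 1 / 2 <= 1].
Proof.
rewrite /triangle /= forall_I3 !tri_normalE /dot !row2E.
by rewrite !(mul0r, add0r, mulN1r, mulNr) !mul1r !(mulrC 2^-1).
Qed.

Lemma triangle_convex : convex_set triangle.
Proof.
move=> x y r; rewrite !inE => Kx Ky i.
rewrite /conv /= dotDr !dotZr.
have := Kx i; have := Ky i; have : 0 <= r%:inum <= 1 by apply/andP.
rewrite /unstable.onem; move: (dot _ x) (dot _ y) (r%:inum) => a b s /andP[s0 s1] b1 a1; nra.
Qed.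

Lemma dot_continuous (u : 'rV[R]_2) : continuous (dot u).
Proof.
have cj j : continuous (fun v : 'rV[R]_2 => u 0 j * v 0 j).
  move=> p; apply: (@continuousM _ _ (cst (u 0 j)) (fun v : 'rV[R]_2 => v 0 j)).
    exact: cst_continuous.
  exact: coord_continuous.
by move=> p; exact: (continuousD (cj 0 p) (cj 1 p)).
Qed.

Lemma sqrt3_gt1 : 1 < Num.sqrt 3 :> R.
Proof. by have := @sqrt3_sqr R; have := @sqrt3_gt0 R; nra. Qed.

Lemma triangle_closed : closed triangle.
Proof.
rewrite (_ : triangle = \bigcap_(i in setT) (dot (tri_normal i) @^-1` [set r | r <= 1])).
  apply: closed_bigI => i _; apply: preimage_closed; last exact: closed_le.
  by move=> p _; exact: dot_continuous.
by apply/seteqP; split=> [p Kp i _|p Kp i]; apply: Kp.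
Qed.

Lemma triangle_bound p : triangle p -> `|p 0 0| <= 2 /\ `|p 0 1| <= 2.
Proof.
move=> /triangleP[p1 p2 p3]; have s1 := sqrt3_gt1; have s3 := @sqrt3_sqr R.
split; rewrite ler_norml; apply/andP; split; try lra; nra.
Qed.

Lemma triangle_bounded : bounded_set triangle.
Proof.
exists 2; split; first exact: num_real.
move=> M M2 p /triangle_bound[b0 b1].
rewrite /= [X in X <= _]/Num.norm /= mx_normrE.
apply/bigmax_leP; split; first lra.
move=> [i j] _ /=; rewrite (ord1 i).
case: (unliftP ord0 j) => [l|] ->; last by apply: le_trans b0 _; lra.
by rewrite (ord1 l) (_ : lift _ _ = 1); [apply: le_trans b1 _; lra | exact/val_inj].
Qed.

Lemma row2_near0 (r : R) p : 0 < r -> ball (0 : 'rV[R]_2) r p -> forall j, `|p 0 j| < r.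
Proof.
by move=> r0 [_ bp] j; have := bp 0 j; rewrite mxE /ball /= sub0r normrN.
Qed.

Lemma triangle_body : convex_body triangle.
Proof.
split.
- exact: bounded_closed_compact triangle_bounded triangle_closed.
- exact: triangle_convex.
exists 0; apply/nbhs_ballP; exists (1 / 2) => /=; first lra.
move=> p /row2_near0 bp; have {}bp : forall j, `|p 0 j| < 1 / 2 by apply: bp; lra.
have := bp 0; have := bp 1; rewrite !ltr_norml => /andP[? ?] /andP[? ?].
have s0 := sqrt3_gt1; have s3 := @sqrt3_sqr R.
apply/triangleP; split; first lra.
- nra.
- nra.
Qed.

Lemma xiB_triangle : xiB triangle <= 3 * Num.sqrt 3.
Proof.
apply: ge_inf; first by exists 0; exact: xi_lengths_ge0.
have s0 := @sqrt3_gt0 R; have s3 := @sqrt3_sqr R.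
exists 3; split=> //; exists tri_normal => [t tN|]; last first.
  rewrite /closed_length sum_I3.
  have -> : ordS ord0 = I3_1 by exact/val_inj.
  have -> : ordS I3_1 = I3_2 by exact/val_inj.
  have -> : ordS I3_2 = ord0 by exact/val_inj.
  have n (u : 'rV[R]_2) : dot u u = 3 -> enorm u = Num.sqrt 3 by rewrite enormE => ->.
  rewrite !n; first by ring.
  1-3: by rewrite !tri_normalE /dot !mxE /=; nra.
(* Interior points satisfy the constraints strictly, so [t] has positive product with all three
   normals, although these sum to 0. *)
have lt1 i : dot (tri_normal i) t > 0.
  have [k intk kt] := tN (tri_normal i) (imageT _ _).
  set u := tri_normal i in kt *.
  have [s sp] := interior_push _ _ u intk.
  move=> /(_ i); rewrite -/u dotDr dotZr dot_tri_normal.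
  have : dot u (k + t) = 1 by rewrite kt dot_tri_normal.
  rewrite dotDr; lra.
have := lt1 ord0; have := lt1 I3_1; have := lt1 I3_2.
by rewrite !tri_normalE /dot !row2E; lra.
Qed.

(** A point [y] with both [y] and [y + p] in the triangle is sought, that is, with products at most
    [c i]. It exists once the [c i] have nonnegative sum; this holds as the [s i] sum to 0 and lie
    in [-3, 3], so their positive parts sum to at most 3. *)
Lemma disc_sub_diff_triangle p : enorm p <= 3 -> diff_body triangle p.
Proof.
move=> p3; have s0 := @sqrt3_gt0 R; have s3 := @sqrt3_sqr R.
have uu i : enorm (tri_normal i) = 1 by rewrite enormE dot_tri_normal sqrtr1.
pose s i := dot (tri_normal i) p.
have sle i : - 3 <= s i <= 3.
  have := dot_le (tri_normal i) p; have := dot_le (tri_normal i) (- p).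
  rewrite dotNr enormN uu mul1r -/(s i) => ? ?; apply/andP; split; lra.
have ssum : s ord0 + s I3_1 + s I3_2 = 0.
  by rewrite /s !tri_normalE /dot !row2E; field.
pose c i := Num.min 1 (1 - s i).
(* The point with [dot (tri_normal i) y = c i - (c 0 + c 1 + c 2) / 3]. *)
pose y := (2 / 3) *: (c ord0 *: tri_normal ord0 + c I3_1 *: tri_normal I3_1 +
                      c I3_2 *: tri_normal I3_2).
have c0 : 0 <= c ord0 + c I3_1 + c I3_2.
  have := sle ord0; have := sle I3_1; have := sle I3_2.
  rewrite /c; move: (s _) (s _) (s _) ssum => a b d ssum /andP[? ?] /andP[? ?] /andP[? ?].
  by rewrite !minEle; case: ifPn => ?; case: ifPn => ?; case: ifPn => ?; lra.
have yc i : dot (tri_normal i) y <= c i.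
  have := c0; move: i; apply/forall_I3.
  rewrite /y !dotZr !dotDr !dotZr !tri_normalE /dot !row2E.
  have sc (z : R) : Num.sqrt 3 * (Num.sqrt 3 * z) = 3 * z by rewrite mulrA -expr2 s3.
  have := sc (c I3_1); have := sc (c I3_2).
  by split; lra.
exists (y + p); last first.
  exists y; last by rewrite addrC addKr.
  by move=> i; apply: le_trans (yc i) _; rewrite /c ge_min lexx.
move=> i; rewrite dotDr -/(s i).
have : c i <= 1 - s i by rewrite /c ge_min lexx orbT.
by have := yc i; lra.
Qed.

Lemma open_disc_interior (A : set 'rV[R]_2) (r : R) p :
  (forall p, enorm p <= r -> A p) -> enorm p < r -> interior A p.
Proof.
move=> rA pr; set d := r - enorm p; have d0 : 0 < d by rewrite subr_gt0.
(* Balls are squares for the sup norm; half-side [d / 2] keeps Euclidean distances below [d]. *)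
apply/nbhs_ballP; exists (d / 2) => /=; first by rewrite divr_gt0.
move=> x [_ bx]; apply: rA.
have bxj j : `|p 0 j - x 0 j| < d / 2 by exact: bx.
have : enorm (x - p) <= d.
  rewrite enorm_le ?ltW // /dot !mxE.
  have := bxj 0; have := bxj 1; rewrite !ltr_norml => /andP[? ?] /andP[? ?]; nra.
by have := ler_enormD (x - p) p; rewrite subrK /d; lra.
Qed.

Lemma xiB_ge_disc (A : set 'rV[R]_2) (r : R) : 0 <= r -> xi_lengths A !=set0 ->
  (forall p, enorm p <= r -> A p) -> 4 * r <= xiB A.
Proof.
move=> r0 A0 rA; apply: lb_le_inf => // l [m [_ [q Pq <-]]].
rewrite leNgt; apply/negP => Lr; have [c cq] := closed_polygon_in_disc m q.
apply: (Pq c) => _ [i _ <-]; exists (q i - c); last exact: subrK.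
apply: (open_disc_interior _ r) => //; apply: le_lt_trans (cq i) _; lra.
Qed.

Lemma xiB_diff_triangle : 12 <= xiB (diff_body triangle).
Proof.
have -> : 12 = 4 * 3 :> R by ring.
apply: xiB_ge_disc => //; last exact: disc_sub_diff_triangle.
apply: (xi_lengths_neq0 _ 4) => _ [x /triangle_bound[bx _] [y /triangle_bound[yb _] <-]].
by rewrite !mxE; apply: le_trans (ler_normB _ _) _; lra.
Qed.

End Triangle.

(** * The inequality and its sharpness *)

Theorem theorem2p2 (R : realType) :
  (forall K : set 'rV[R]_2, convex_body K ->
     xiB (diff_body K) <= 4 / Num.sqrt 3 * xiB K) /\
  (forall c : R, c < 4 / Num.sqrt 3 ->
     ~ (forall K : set 'rV[R]_2, convex_body K ->
          xiB (diff_body K) <= c * xiB K)).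
Proof.
split=> [K|c c_lt H]; first exact: xiB_diff_body_le.
have s0 := @sqrt3_gt0 R; have s3 := @sqrt3_sqr R.
have x0 : 0 <= xiB (@triangle R).
  apply: lb_le_inf; last exact: xi_lengths_ge0.
  by have [cK _ _] := @triangle_body R; exact: compact_xi_lengths.
have xD := le_trans xiB_diff_triangle (H _ triangle_body).
have xT := @xiB_triangle R.
have c4 : c * Num.sqrt 3 < 4 by rewrite -ltr_pdivlMr.
(* For positive [c] the triangle gives 12 <= 3 sqrt 3 c < 12. For the other sign the bound on
   [xiB triangle] cannot be multiplied by [c], but then [c * xiB triangle] is at most 0. *)
have [c0|c0] := leP c 0.
  by have := mulr_le0_ge0 c0 x0; lra.
by have := ler_wpM2l (ltW c0) xT; lra.
Qed.
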